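(* Let $p$ be an odd prime, $m,s$ positive integers, and $\mathcal{R}=\mathbb{F}_{p^m}[u,v]/\langle u^2,v^2,uv-vu\rangle$. Let $\alpha=\alpha_1+\alpha_3v+\alpha_4uv\in\mathcal{R}$ with $\alpha_1,\alpha_3,\alpha_4\in\mathbb{F}_{p^m}^*$, and suppose $\alpha$ is not a square in $\mathcal{R}$. Let $\alpha_0\in\mathbb{F}_{p^m}$ be the element with $\alpha_0^{p^s}=\alpha_1$. Let $\mathcal{C}=\langle (x^2-\alpha_0)^\ell+u(x^2-\alpha_0)^tz(x),\ u(x^2-\alpha_0)^\mu\rangle$ be the ideal of $\mathcal{R}_\alpha=\mathcal{R}[x]/\langle x^{2p^s}-\alpha\rangle$, where $0\le\ell\le 2p^s-1$, $0\le t<\ell$, $z(x)$ is $0$ or a unit, and $0\le\mu<\Im$, where $\Im$ is the smallest non-negative integer such that $u(x^2-\alpha_0)^{\Im}\in\langle (x^2-\alpha_0)^\ell+u(x^2-\alpha_0)^tz(x)\rangle$. Then the Hamming distance of $\mathcal{C}$ is $$d_H(\mathcal{C})=\begin{cases}1 & \text{if } 0\le\mu\le p^s;\\ (\Gamma+1)p^{\gamma} & \text{if } 2p^s-p^{s-\gamma}+(\Gamma-1)p^{s-\gamma-1}+1\le\mu\le 2p^s-p^{s-\gamma}+\Gamma p^{s-\gamma-1},\\ & \text{where } 1\le\Gamma\le p-1 \text{ and } 0\le\gamma\le s-1.\end{cases}$$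
   Context: Elements of $\mathcal{R}_\alpha=\mathcal{R}[x]/\langle x^{2p^s}-\alpha\rangle$ are identified with vectors in $\mathcal{R}^{2p^s}$: the class whose representative of degree less than $2p^s$ is $\zeta_0+\zeta_1x+\cdots+\zeta_{2p^s-1}x^{2p^s-1}$ corresponds to $(\zeta_0,\ldots,\zeta_{2p^s-1})$. Ideals of $\mathcal{R}_\alpha$ are thereby the $\alpha$-constacyclic codes of length $2p^s$ over $\mathcal{R}$. The Hamming weight of a vector is the number of its nonzero entries, and the Hamming distance $d_H(\mathcal{C})$ of a nonzero linear code is the minimum Hamming weight of its nonzero codewords. When $z(x)$ is a unit, it is represented as a finite sum $z(x)=\sum_{\kappa}(z_{0\kappa}x+z_{1\kappa})(x^2-\alpha_0)^\kappa$ with $z_{0\kappa},z_{1\kappa}\in\mathbb{F}_{p^m}$ and $z_{00}x+z_{10}\ne0$. *)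

(* Defs.v *)
From HB Require Import structures.
From mathcomp Require Import all_boot all_order all_algebra.

Set Implicit Arguments.
Unset Strict Implicit.
Unset Printing Implicit Defensive.

Import GRing.Theory.
Local Open Scope ring_scope.

(* The ring F[u,v]/<u^2, v^2, uv - vu>, as the iterated quotient
   (F[u]/<u^2>)[v]/<v^2>; [Rproj_surj] and [Rproj_ker] below check the
   presentation, with F[u,v] = {poly {poly F}}, u = 'X%:P and v = 'X. *)
Definition dual (A : comNzRingType) : comNzRingType :=
  {poly %/ ('X^2 : {poly A})}.

Definition Ruv (F : comNzRingType) : comNzRingType := dual (dual F).

Definition Rconst (F : comNzRingType) (a : F) : Ruv F := qpolyC _ (qpolyC _ a).
Definition Ru (F : comNzRingType) : Ruv F := qpolyC _ 'qX.
Definition Rv (F : comNzRingType) : Ruv F := 'qX.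

Definition Ralpha (F : comNzRingType) (a1 a3 a4 : F) : Ruv F :=
  Rconst a1 + Rconst a3 * Rv F + Rconst a4 * (Ru F * Rv F).

(* A[x]/<x^N - a>, for 0 < N (see [mk_monic_constacyclic]); an element is the
   polynomial of degree < N representing its class. *)
Definition constacyclic (A : comNzRingType) (N : nat) (a : A) : comNzRingType :=
  {poly %/ ('X^N - a%:P : {poly A})}.

Lemma mk_monic_constacyclic (A : comNzRingType) (N : nat) (a : A) :
  (0 < N)%N -> mk_monic ('X^N - a%:P) = 'X^N - a%:P.
Proof.
move=> N0; have szE : size ('X^N - a%:P : {poly A}) = N.+1.
  exact: size_XnsubC.
have mon : 'X^N - a%:P \is monic by exact: monicXnsubC.
by rewrite /mk_monic szE ltnS N0 mon.
Qed.

Definition cx (A : comNzRingType) (N : nat) (a : A) : constacyclic N a := 'qX.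
Definition cC (A : comNzRingType) (N : nat) (a c : A) : constacyclic N a :=
  qpolyC _ c.

Definition codeword (A : comNzRingType) (N : nat) (a : A)
    (c : constacyclic N a) : 'rV[A]_N :=
  poly_rV (c : {poly %/ ('X^N - a%:P : {poly A})}).

Definition hweight (A : comNzRingType) (N : nat) (w : 'rV[A]_N) : nat :=
  #|[set i : 'I_N | w 0 i != 0]|.

Definition least (P : nat -> Prop) (n : nat) : Prop :=
  P n /\ forall k, P k -> (n <= k)%N.

Definition hamming_distance (A : comNzRingType) (N : nat) (a : A)
    (C : constacyclic N a -> Prop) (d : nat) : Prop :=
  least (fun w => exists c, [/\ C c, c != 0 & hweight (codeword c) = w]) d.

Definition ideal_gen (A : comNzRingType) (gs : seq A) (c : A) : Prop :=
  exists r : nat -> A, c = \sum_(i < size gs) r i * gs`_i.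

(* The quotient rings carry no unitRingType structure. *)
Definition is_unit (A : comNzRingType) (c : A) : Prop := exists d, d * c = 1.

(* The elements u, c (a constant of F), and x^2 - a0 of R[x]/<x^N - a>. *)
Definition cu (F : comNzRingType) (N : nat) (a : Ruv F) : constacyclic N a :=
  cC N a (Ru F).

Definition cF (F : comNzRingType) (N : nat) (a : Ruv F) (c : F) :
  constacyclic N a := cC N a (Rconst c).

Definition cf (F : comNzRingType) (N : nat) (a : Ruv F) (a0 : F) :
  constacyclic N a := cx N a ^+ 2 - cF N a a0.

Definition unit_form (F : comNzRingType) (N : nat) (a : Ruv F) (a0 : F)
    (z : constacyclic N a) : Prop :=
  exists (K : nat) (z0 z1 : nat -> F),
    cF N a (z0 0%N) * cx N a + cF N a (z1 0%N) != 0 /\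
    z = \sum_(k < K.+1)
          (cF N a (z0 k) * cx N a + cF N a (z1 k)) * cf N a a0 ^+ k.

Definition code_gen (F : comNzRingType) (N : nat) (a : Ruv F) (a0 : F)
    (l t : nat) (z : constacyclic N a) : constacyclic N a :=
  cf N a a0 ^+ l + cu N a * cf N a a0 ^+ t * z.

Definition Rproj (F : comNzRingType) (f : {poly {poly F}}) : Ruv F :=
  in_qpoly ('X^2 : {poly dual F})
    (map_poly (in_qpoly ('X^2 : {poly F}) : {poly F} -> dual F) f).

Lemma in_dual_eq0 (A : comNzRingType) (f : {poly A}) :
  (in_qpoly ('X^2 : {poly A}) f : dual A) = 0 <-> exists g, f = g * 'X^2.
Proof.
have E : (in_qpoly ('X^2 : {poly A}) f : {poly A}) = take_poly 2 f.
  rewrite /= mk_monic_Xn /=.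
  rewrite -{1}(poly_take_drop 2 f) addrC Pdiv.RingMonic.rmodp_addl_mul_small //.
    exact: monicXn.
  by rewrite size_polyXn ltnS size_take_poly.
split=> [h|[g fE]].
  exists (drop_poly 2 f); rewrite -{1}(poly_take_drop 2 f) -E.
  by move: h => /(congr1 val) /= ->; rewrite add0r.
apply/val_inj; rewrite [LHS]E fE /=; apply/polyP=> i.
by rewrite coef_take_poly coefMXn coef0; case: ltnP.
Qed.

Lemma in_dual_surj (A : comNzRingType) (c : dual A) :
  exists f : {poly A}, in_qpoly 'X^2 f = c.
Proof.
exists (c : {poly %/ ('X^2 : {poly A})}); apply/val_inj => /=.
by rewrite Pdiv.CommonRing.rmodp_small ?size_mk_monic.
Qed.

Lemma Rproj_is_zmod_morphism (F : comNzRingType) : zmod_morphism (@Rproj F).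
Proof. by move=> f g; rewrite /Rproj !rmorphB. Qed.

Lemma Rproj_is_monoid_morphism (F : comNzRingType) :
  monoid_morphism (@Rproj F).
Proof. by split=> [|f g]; rewrite /Rproj ?rmorph1 ?rmorphM. Qed.

HB.instance Definition _ (F : comNzRingType) :=
  GRing.isZmodMorphism.Build _ _ (@Rproj F) (@Rproj_is_zmod_morphism F).
HB.instance Definition _ (F : comNzRingType) :=
  GRing.isMonoidMorphism.Build _ _ (@Rproj F) (@Rproj_is_monoid_morphism F).

Lemma in_dualC (A : comNzRingType) (b : A) :
  in_qpoly ('X^2 : {poly A}) b%:P = qpolyC ('X^2 : {poly A}) b.
Proof.
apply/val_inj => /=; rewrite mk_monic_Xn Pdiv.CommonRing.rmodp_small //.
by rewrite size_polyXn (leq_ltn_trans (size_polyC_leq1 _)).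
Qed.

Lemma Rproj_const (F : comNzRingType) (a : F) : Rproj a%:P%:P = Rconst a.
Proof. by rewrite /Rproj map_polyC /= !in_dualC. Qed.

Lemma Rproj_u (F : comNzRingType) : Rproj 'X%:P = Ru F.
Proof. by rewrite /Rproj map_polyC /= in_dualC. Qed.

Lemma Rproj_v (F : comNzRingType) : Rproj 'X = Rv F.
Proof. by rewrite /Rproj map_polyX. Qed.

Lemma Rproj_surj (F : comNzRingType) (c : Ruv F) : exists f, Rproj f = c.
Proof.
have [g <-] := in_dual_surj c.
suff [f <-] : exists f : {poly {poly F}},
    map_poly (in_qpoly ('X^2 : {poly F}) : {poly F} -> dual F) f = g
  by exists f.
elim/poly_ind: g => [|g b [f <-]]; first by exists 0; rewrite rmorph0.
have [d <-] := in_dual_surj b.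
by exists (f * 'X + d%:P); rewrite rmorphD rmorphM /= map_polyX map_polyC.
Qed.

Lemma Rproj_ker (F : comNzRingType) (f : {poly {poly F}}) :
  Rproj f = 0 <-> ideal_gen [:: 'X%:P ^+ 2; 'X ^+ 2; 'X%:P * 'X - 'X * 'X%:P] f.
Proof.
rewrite /ideal_gen /=; split=> [/in_dual_eq0 [g fE]|[r ->]].
  have low i : (i < 2)%N -> exists h, f`_i = h * 'X^2.
    move=> lti; apply/in_dual_eq0.
    have := congr1 (fun q : {poly dual F} => q`_i) fE.
    by rewrite coef_map /= coefMXn lti.
  have [h0 E0] := low 0%N isT; have [h1 E1] := low 1%N isT.
  exists (nth 0 [:: h0%:P + h1%:P * 'X; drop_poly 2 f; 0]).
  rewrite !big_ord_recl big_ord0 /= mul0r !addr0.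
  rewrite -{1}(poly_take_drop 2 f); congr (_ + _).
  apply/polyP=> i; rewrite coef_take_poly mulrDl mulrAC -rmorphXn -!rmorphM /=.
  rewrite coefD coefC coefMX coefC.
  by case: i => [|[|i]] /=; rewrite ?E0 ?E1 ?addr0 ?add0r.
rewrite !big_ord_recl big_ord0 /= [_ * 'X%:P]mulrC subrr mulr0 !addr0.
rewrite rmorphD (rmorphM _ (r 0%N)) (rmorphM _ (r 1%N)) /=.
have -> : Rproj ('X%:P * 'X%:P : {poly {poly F}}) = 0.
  rewrite /Rproj -rmorphM /= map_polyC /=.
  have -> : (in_qpoly 'X^2 ('X * 'X) : dual F) = 0.
    by apply/in_dual_eq0; exists 1; rewrite mul1r.
  by rewrite polyC0 in_qpoly0.
have -> : Rproj ('X * 'X : {poly {poly F}}) = 0.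
  by apply/in_dual_eq0; exists 1; rewrite rmorphM /= map_polyX mul1r.
by rewrite !mulr0 addr0.
Qed.

(* Main.v *)
(* Put f = x^2 - a0. As f^(p^s) = x^(2 p^s) - a1 is v times a unit, u v is u
   f^(p^s) up to a scalar, f^(2 p^s) = 0, and every multiple of u in R_alpha
   is u G(x) with G in F[x] unique modulo f^(2 p^s). If c is a nonzero
   codeword, either u c <> 0 is a codeword in <u f^mu> of no larger weight,
   or u c = 0, and then the minimality of Im forces c itself into <u f^mu>.
   For mu <= p^s that ideal contains u v. For mu = p^s + j with j > 0 its
   nonzero elements are u v G(x) with G of degree < 2 p^s divisible by (x^2 -
   a0)^j; splitting G into even and odd parts, one is left with the weights
   of the polynomials of degree < p^s divisible by (x - a0)^j. Writing such a
   polynomial as (x - a0)^((p - 1) p^(s - 1)) h when j exceeds that exponent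
   multiplies the weight of h by p, which reduces the question to the first
   base-p digit of j. *)

Require Import Defs.
From HB Require Import structures.
From mathcomp Require Import all_boot all_order all_algebra finfield zify.

Set Implicit Arguments.
Unset Strict Implicit.
Unset Printing Implicit Defensive.

Import GRing.Theory.
Local Open Scope ring_scope.

(** * Weights of polynomials and sections modulo q *)

Definition poly_weight (A : nzSemiRingType) (P : {poly A}) : nat :=
  (\sum_(0 <= i < size P) (P`_i != 0)%R)%N.

(** With [S_e] for [section q e P], [P] is the sum of [X^e S_e(X^q)] over [e < q]. It serves with
    [q = 2] and with [q] a power of [p]. *)
Definition section (A : nzSemiRingType) (q e : nat) (P : {poly A}) : {poly A} :=
  \poly_(k < size P) P`_(k * q + e).

Section Weight.

Variable A : nzSemiRingType.
Implicit Types P : {poly A}.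

Lemma poly_weightE N P :
  (size P <= N)%N -> poly_weight P = (\sum_(0 <= i < N) (P`_i != 0)%R)%N.
Proof.
move=> leN; rewrite /poly_weight [RHS](big_cat_nat (n := size P)) //=
  -[LHS]addn0.
congr (_ + _)%N; rewrite big_nat big1 // => i /andP[szi _].
by rewrite nth_default ?eqxx.
Qed.

Lemma poly_weight_le N P : (size P <= N)%N -> (poly_weight P <= N)%N.
Proof.
move=> /poly_weightE ->; rewrite -[leqRHS]subn0 -[leqRHS]muln1
  -sum_nat_const_nat.
by apply: leq_sum => i _; case: eqP.
Qed.

Lemma poly_weight_gt0 P : (0 < poly_weight P)%N = (P != 0).
Proof.
apply/idP/idP => [|P0].
  by apply: contraTneq => ->; rewrite /poly_weight size_poly0 big_geq.
rewrite /poly_weight -[size P]prednK ?size_poly_gt0 // big_nat_recr //=.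
by rewrite -lead_coefE lead_coef_eq0 P0 addn1.
Qed.

Lemma poly_weight0 : poly_weight (0 : {poly A}) = 0%N.
Proof. by apply/eqP; rewrite -leqn0 leqNgt poly_weight_gt0 eqxx. Qed.

Lemma coef_section q e P k : (0 < q)%N -> (section q e P)`_k = P`_(k * q + e).
Proof.
move=> q0; rewrite coef_poly; case: ltnP => // szk.
by rewrite nth_default // (leq_trans szk) // -{1}[k]muln1
  (leq_trans _ (leq_addr _ _)) // leq_mul2l q0 orbT.
Qed.

Lemma size_section q e P n :
  (0 < q)%N -> (size P <= n * q)%N -> (size (section q e P) <= n)%N.
Proof.
move=> q0 szP; apply/leq_sizeP => k nk; rewrite coef_section // nth_default //.
by rewrite (leq_trans szP) // (leq_trans _ (leq_addr _ _)) // leq_mul2r nk orbT.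
Qed.

Lemma poly_weight_section q P :
  (0 < q)%N -> poly_weight P = (\sum_(e < q) poly_weight (section q e P))%N.
Proof.
move=> q0; have szP : (size P <= size P * q)%N by rewrite leq_pmulr.
rewrite (poly_weightE szP) big_nat_mul.
under eq_bigr => k _ do rewrite -{1}[(k * q)%N]add0n mulSn big_addn addnK
  big_mkord.
rewrite exchange_big /=; apply: eq_bigr => e _.
rewrite (poly_weightE (size_section e q0 szP)); apply: eq_bigr => k _.
by rewrite coef_section // addnC.
Qed.

Lemma section_eq0 q P : (0 < q)%N -> P != 0 ->
  exists2 e, (e < q)%N & section q e P != 0.
Proof.
move=> q0; rewrite -poly_weight_gt0 (poly_weight_section P q0) lt0n sum_nat_eq0
  negb_forall.
by move=> /existsP[e]; rewrite /= -lt0n poly_weight_gt0 => h; exists e.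
Qed.

End Weight.

(** Multiplication by [X^q] shifts each section by one place; as [e < q], nothing enters at index
    0. *)
Lemma section_compM (A : comNzRingType) q e (g h : {poly A}) :
  (e < q)%N -> section q e ((g \Po 'X^q) * h) = g * section q e h.
Proof.
move=> eq; have q0 : (0 < q)%N by apply: leq_ltn_trans eq.
elim/poly_ind: g => [|g c IH]; first by
  rewrite comp_poly0 !mul0r; apply/polyP=> k; rewrite coef_section ?coef0.
rewrite comp_polyD comp_polyM comp_polyX comp_polyC !mulrDl !mul_polyC.
rewrite -[in RHS]mulrA [in RHS]mulrCA -IH; apply/polyP=> k.
rewrite coef_section // !coefD !coefZ coefXM !coef_section //.
congr (_ + _); rewrite mulrAC coefMXn.
case: k => [|k] /=; first by rewrite mul0n eq.
by rewrite mulSn -addnA addKn ltnNge leq_addr.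
Qed.

(** For [k < p] the left side has base-[p] digits [p - 1] ([g + 1] times), [k], then [r] zeros; the
    identity splits off the leading digit. *)
Lemma expn_gapS p g r k : (0 < p)%N ->
  ((p ^ g.+1).-1 * p ^ r.+1 + k * p ^ r
   = p.-1 * p ^ (g + r).+1 + ((p ^ g).-1 * p ^ r.+1 + k * p ^ r))%N.
Proof.
move=> p0; rewrite addnA; congr (_ + _)%N; rewrite -addnS expnD mulnA -mulnDl.
congr (_ * _)%N; have := expn_gt0 p g; rewrite p0 expnS -!subn1 => ?; nia.
Qed.

Lemma exprBn_pchar (R : comNzRingType) (x y : R) n :
  [pchar R].-nat n -> (x - y) ^+ n = x ^+ n - y ^+ n.
Proof. by move=> pn; rewrite exprDn_pchar // exprNn_pchar. Qed.

(** * Multiples of powers of X - a in characteristic p *)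

Section Frobenius.

Variables (F : fieldType) (p : nat).
Hypothesis pF : p \in [pchar F].
Implicit Types (a : F) (P h : {poly F}).

Let p_pr : prime p := pcharf_prime pF.
Let p_gt0 : (0 < p)%N := prime_gt0 p_pr.

Lemma XsubC_exp_pchar_comp a n k :
  ('X - a%:P) ^+ (k * p ^ n) = (('X - (a ^+ (p ^ n))%:P) ^+ k) \Po 'X^(p ^ n).
Proof.
rewrite rmorphXn /= comp_polyB comp_polyX comp_polyC mulnC exprM.
congr (_ ^+ _); have pn : [pchar {poly F}].-nat (p ^ n)%N.
  by rewrite pnatX pnatE // pchar_poly pF.
by rewrite exprBn_pchar // rmorphXn.
Qed.

(* [X P' - n P], with [n] the degree of [P], loses the leading term of [P] and
   keeps all but one of its multiplicity at [a]. *)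
Lemma XsubC_exp_dvd_weight_small a k P : a != 0 -> P != 0 -> (size P <= p)%N ->
  ('X - a%:P) ^+ k %| P -> (k < poly_weight P)%N.
Proof.
move=> a0; elim: k P => [|k IH] P P0 szP dvP; first by rewrite poly_weight_gt0.
set n := (size P).-1; have szE : size P = n.+1 by rewrite prednK ?size_poly_gt0.
pose D := 'X * P^`() - n%:R *: P.
have DE i : D`_i = (i%:R - n%:R) * P`_i.
  rewrite coefB coefXM coefZ coef_deriv mulrBl; congr (_ - _).
  case: i => [|i] /=; rewrite ?mul0r //.
  by rewrite mulr_natl.
have szD : (size D <= n)%N.
  apply/leq_sizeP => i; rewrite leq_eqVlt DE => /predU1P[<-|ni].
    by rewrite subrr mul0r.
  by rewrite [P`_i]nth_default ?mulr0 // szE.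
suff D0 : D != 0.
  rewrite (@leq_trans (poly_weight D).+1) // ?ltnS; last first.
    rewrite (poly_weightE szD) /poly_weight szE big_nat_recr //=.
    rewrite -[P`_n]lead_coefE lead_coef_eq0 P0 addn1 ltnS.
    by apply: leq_sum => i _; rewrite DE mulf_eq0; do 2!case: (_ == 0).
  apply: IH => //.
    by rewrite (leq_trans szD) // -ltnS -szE (leq_trans szP).
  have dvP' := dvdp_trans (dvdp_exp2l _ (leqnSn k)) dvP.
  rewrite dvdp_sub //; last by rewrite -mul_polyC dvdp_mull.
  apply: dvdp_mull.
  move/dvdpP: dvP => [Q ->]; rewrite derivM deriv_exp /= -mulr_natl.
  by rewrite dvdp_add ?dvdp_mull // dvdp_exp2l.
(* Since [n < p], [D = 0] would make [P] a nonzero monomial, which cannot vanish at [a != 0]. *)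
apply/eqP => D0.
have PE : P = P`_n *: 'X^n.
  apply/polyP => i; rewrite !coefE.
  have [->|ni] := eqVneq i n; first by rewrite mulr1.
  rewrite mulr0; case: (ltnP i (size P)) => [|/leq_sizeP->//].
  rewrite szE ltnS leq_eqVlt (negPf ni) /= => lti.
  have /eqP := DE i; rewrite D0 coef0 eq_sym mulf_eq0 -opprB.
  rewrite -natrB ?(ltnW lti) //.
  rewrite oppr_eq0 -(dvdn_pcharf pF) gtnNdvd ?subn_gt0 //=.
    by move/eqP.
  by rewrite (leq_ltn_trans (leq_subr _ _)) // -szE.
have : root P a.
  by rewrite -dvdp_XsubCl (dvdp_trans _ dvP) // dvdp_exp.
rewrite PE rootE !hornerE mulf_eq0 expf_eq0 (negPf a0) andbF orbF.
by rewrite -[P`_n]lead_coefE lead_coef_eq0 (negPf P0).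
Qed.

(** There are only [k + 1] coefficients, and divisibility by [(X - a)^k] forces more than [k]
    nonzero ones. *)
Lemma poly_weight_XsubC_exp_small a k : a != 0 -> (k < p)%N ->
  poly_weight (('X - a%:P) ^+ k) = k.+1.
Proof.
move=> a0 kp; apply/eqP; rewrite eqn_leq poly_weight_le ?size_exp_XsubC //=.
by rewrite (XsubC_exp_dvd_weight_small a0) ?size_exp_XsubC // expf_neq0
  ?polyXsubC_eq0.
Qed.

Lemma poly_weightMC a P : a != 0 -> poly_weight (P * a%:P) = poly_weight P.
Proof.
move=> a0; rewrite /poly_weight mulrC mul_polyC size_scale //.
by apply: eq_bigr => i _; rewrite coefZ mulf_eq0 (negPf a0).
Qed.

Lemma section_small q e h : (0 < q)%N -> (size h <= q)%N ->
  section q e h = (h`_e)%:P.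
Proof.
move=> q0 szh; apply/polyP => -[|k]; rewrite coef_section // coefC //=.
by rewrite nth_default // (leq_trans szh) // mulSn -addnA leq_addr.
Qed.

(* [(X - a)^(k p^n)] is [(Y - b)^k] with [Y = X^(p^n)]: its [k + 1] coefficients
   are nonzero, and the corresponding shifts of [h] do not overlap. *)
Lemma poly_weight_XsubC_expM a n k h : a != 0 -> (k < p)%N ->
  (size h <= p ^ n)%N ->
  poly_weight (('X - a%:P) ^+ (k * p ^ n) * h) = (k.+1 * poly_weight h)%N.
Proof.
move=> a0 kp szh; have q0 : (0 < p ^ n)%N by rewrite expn_gt0 p_gt0.
rewrite (poly_weight_section _ q0) (poly_weightE szh) big_mkord big_distrr /=.
apply: eq_bigr => e _.
rewrite XsubC_exp_pchar_comp section_compM // section_small //.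
have [->|h0] := eqVneq h`_e 0; first by rewrite mulr0 poly_weight0 muln0.
by rewrite poly_weightMC // poly_weight_XsubC_exp_small ?expf_neq0 // muln1.
Qed.

(** If [a^(p^n)] has multiplicity [r] in [P], then [a] has multiplicity exactly [r p^n] in
    [P(X^(p^n))], whence [k < r]. *)
Lemma XsubC_comp_exp_dvd a n k P :
  ('X - a%:P) ^+ (k * p ^ n).+1 %| P \Po 'X^(p ^ n) -> P != 0 ->
  ('X - (a ^+ (p ^ n))%:P) ^+ k.+1 %| P.
Proof.
move=> dvP P0; have q0 : (0 < p ^ n)%N by rewrite expn_gt0 p_gt0.
have [r [Q rtQ PE]] := multiplicity_XsubC P (a ^+ (p ^ n)).
rewrite P0 /= in rtQ.
rewrite PE dvdp_mull // dvdp_exp2l // ltnNge; apply/negP => rk.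
move: dvP; rewrite PE rmorphM /= -XsubC_exp_pchar_comp.
have /subnKC <- : (r * p ^ n <= (k * p ^ n).+1)%N.
  by rewrite leqW // leq_mul2r rk orbT.
rewrite exprD [_ * _ ^+ (r * _)]mulrC dvdp_mul2l; last first.
  by rewrite expf_neq0 // polyXsubC_eq0.
move=> dvQ; case/negP: rtQ.
suff: root (Q \Po 'X^(p ^ n)) a by rewrite /root horner_comp hornerXn.
rewrite -dvdp_XsubCl (dvdp_trans _ dvQ) // dvdp_exp // subn_gt0 ltnS.
by rewrite leq_mul2r rk orbT.
Qed.

(* Every section of [P] is divisible by [(X - a^(p^n))^k], so has weight above
   [k] if nonzero; if only one section is nonzero, its multiplicity is that of
   [P] divided by [p^n], which exceeds [k]. *)
Lemma XsubC_exp_dvd_weight_first_digit a n k P : a != 0 -> P != 0 ->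
  (size P <= p ^ n.+1)%N -> ('X - a%:P) ^+ (k * p ^ n).+1 %| P ->
  (k.+1 < poly_weight P)%N.
Proof.
move=> a0 P0 szP dvP; have q0 : (0 < p ^ n)%N by rewrite expn_gt0 p_gt0.
rewrite expnS in szP; set b := a ^+ (p ^ n).
have b0 : b != 0 by rewrite expf_neq0.
have dvS e : (e < p ^ n)%N -> ('X - b%:P) ^+ k %| section (p ^ n) e P.
  move=> elt; have /dvdpP[Q ->] := dvdp_trans (dvdp_exp2l _ (leqnSn _)) dvP.
  by rewrite mulrC XsubC_exp_pchar_comp section_compM // dvdp_mulr.
have wtS e : (e < p ^ n)%N -> section (p ^ n) e P != 0 ->
    (k < poly_weight (section (p ^ n) e P))%N.
  move=> elt S0; apply: (XsubC_exp_dvd_weight_small b0 S0) (dvS e elt).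
  by rewrite size_section.
have [e elt Se0] := section_eq0 q0 P0.
rewrite (poly_weight_section P q0) (bigD1 (Ordinal elt)) //=.
have [/existsP[e' /andP[ne' Se'0]]|] := boolP [exists i : 'I_(p ^ n),
    (i != Ordinal elt) && (section (p ^ n) i P != 0)].
  rewrite (bigD1 e') //= addnA (leq_trans _ (leq_addr _ _)) //.
  by rewrite -addn1 leq_add // ?wtS // poly_weight_gt0.
rewrite negb_exists => /forallP S0.
rewrite (leq_trans _ (leq_addr _ _)) //.
apply: (XsubC_exp_dvd_weight_small b0 Se0); first by rewrite size_section.
apply: XsubC_comp_exp_dvd => //.
have PE : P = 'X^e * (section (p ^ n) e P \Po 'X^(p ^ n)).
  apply/polyP => i; rewrite coefXnM coef_comp_poly_Xn //.
  rewrite {1}(divn_eq i (p ^ n)) -(coef_section (i %% p ^ n)) //.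
  have ilt : (i %% p ^ n < p ^ n)%N by rewrite ltn_mod.
  have [iE|ne] := eqVneq (i %% p ^ n)%N e.
    rewrite iE; have -> : (i < e)%N = false by rewrite ltnNge -iE leq_mod.
    have -> : (i - e = i %/ p ^ n * p ^ n)%N.
      by rewrite {1}(divn_eq i (p ^ n)) iE addnK.
    by rewrite dvdn_mull // mulnK.
  have := S0 (Ordinal ilt); rewrite -val_eqE /= ne /= negbK => /eqP ->.
  rewrite coef0; case: ltnP => // ei; case: ifP => // dv.
  case/eqP: ne; rewrite -{1}(subnK ei) -modnDml (eqP dv) add0n modn_small //.
move: dvP; rewrite {1}PE Gauss_dvdpr // coprimep_expl // coprimep_sym
  coprimep_XsubC.
by rewrite rootE hornerXn expf_neq0.
Qed.

(** Each induction step removes a leading digit [p - 1] of the exponent: [P] is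
    [(X - a)^((p - 1) p^(g + r + 1)) Q] with [Q] of size at most [p^(g + r + 1)], so its weight is
    [p] times that of [Q]. *)
Lemma XsubC_exp_dvd_weight a g r k P : a != 0 -> P != 0 ->
  (size P <= p ^ (g + r).+1)%N ->
  ('X - a%:P) ^+ ((p ^ g).-1 * p ^ r.+1 + k * p ^ r).+1 %| P ->
  (k.+2 * p ^ g <= poly_weight P)%N.
Proof.
move=> a0; elim: g P => [|g IH] P P0 szP.
  by rewrite expn0 /= mul0n muln1; apply: XsubC_exp_dvd_weight_first_digit.
rewrite expn_gapS // -addnS exprD => dvP.
have [Q PE] := dvdpP _ _ (dvdp_trans (dvdp_mulr _ (dvdpp _)) dvP).
have X0 i : ('X - a%:P) ^+ i != 0 by rewrite expf_neq0 // polyXsubC_eq0.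
move: P0 szP dvP; rewrite PE mulrC dvdp_mul2l // => PQ0 szP dvQ.
have Q0 : Q != 0 by apply: contraNneq PQ0 => ->; rewrite mulr0.
have szQ : (size Q <= p ^ (g + r).+1)%N.
  move: szP; rewrite size_mul // size_exp_XsubC addSn [in leqRHS]expnS /=.
  by rewrite -[X in (_ <= X * _)%N](prednK p_gt0) mulSnr leq_add2l.
rewrite poly_weight_XsubC_expM ?prednK // expnS mulnCA leq_mul2l.
by rewrite IH ?orbT.
Qed.

(** When [k + 1 < p], taking [k + 1] for [k] shows that the bound of [XsubC_exp_dvd_weight] is
    attained. *)
Lemma poly_weight_XsubC_exp a g r k : a != 0 -> (k < p)%N ->
  poly_weight (('X - a%:P) ^+ ((p ^ g).-1 * p ^ r.+1 + k * p ^ r))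
  = (k.+1 * p ^ g)%N.
Proof.
move=> a0 kp; elim: g => [|g IH].
  rewrite expn0 mul0n muln1 -[_ ^+ _]mulr1 poly_weight_XsubC_expM //.
    by rewrite /poly_weight size_polyC oner_eq0 big_nat1 coefC /= oner_eq0
      muln1.
  by rewrite size_polyC oner_eq0 expn_gt0 p_gt0.
rewrite expn_gapS // exprD poly_weight_XsubC_expM ?prednK //.
  by rewrite IH [in RHS]expnS mulnCA.
rewrite size_exp_XsubC -[(g + r).+1]addnS expnD.
rewrite -[X in (_ <= X * _)%N]prednK ?expn_gt0 ?p_gt0 //.
by rewrite mulSnr ltn_add2l expnS ltn_mul2r expn_gt0 p_gt0.
Qed.

End Frobenius.

(** Among the [s] base-[p] digits of [j - 1], [g] counts the leading ones equal to [p - 1] and [k]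
    is the next one; it exists because [j - 1 < p^s - 1]. *)
Lemma digit_position p s j : (0 < p)%N -> (0 < j < p ^ s)%N ->
  exists g r k, [/\ s = (g + r).+1, (k.+1 < p)%N &
    ((p ^ g).-1 * p ^ r.+1 + k * p ^ r < j
      <= (p ^ g).-1 * p ^ r.+1 + k.+1 * p ^ r)%N].
Proof.
move=> p0; elim: s j => [|s IH] j; first by rewrite expn0; case: j => [|[]].
move=> /andP[j0 jlt]; have ps : (0 < p ^ s)%N by rewrite expn_gt0 p0.
have [jle|jgt] := leqP j (p.-1 * p ^ s).
  (* The leading digit of [j - 1] is already smaller than [p - 1]. *)
  exists 0%N, s, (j.-1 %/ p ^ s)%N.
  rewrite expn0 mul0n !add0n -(prednK j0) /= ltnS.
  split=> //; last by rewrite leq_divM ltn_ceil.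
  by rewrite -[ltnRHS](prednK p0) ltnS ltn_divLR // prednK.
have [|g [r [k [sE kp /andP[lo hi]]]]] := IH (j - p.-1 * p ^ s)%N.
  rewrite subn_gt0 jgt ltn_subLR ?(ltnW jgt) // -mulSnr prednK // -expnS.
  exact: jlt.
exists g.+1, r, k; rewrite sE; split=> //.
rewrite !expn_gapS // -sE -(subnKC (ltnW jgt)) ltn_add2l leq_add2l.
by rewrite lo.
Qed.

(** * Multiples of powers of X^q - a *)

Lemma XnsubC_exp_dvd_weight (F : fieldType) (p q : nat) (a : F) g r k
    (P : {poly F}) :
  p \in [pchar F] -> (0 < q)%N -> a != 0 -> P != 0 ->
  (size P <= q * p ^ (g + r).+1)%N ->
  ('X^q - a%:P) ^+ ((p ^ g).-1 * p ^ r.+1 + k * p ^ r).+1 %| P ->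
  (k.+2 * p ^ g <= poly_weight P)%N.
Proof.
move=> pF q0 a0 P0 szP dvP.
(* One nonzero section modulo [q] suffices: it is divisible by the same power of [X - a]. *)
have [e elt Se0] := section_eq0 q0 P0.
rewrite (poly_weight_section P q0) (bigD1 (Ordinal elt)) //=.
rewrite (leq_trans _ (leq_addr _ _)) //.
apply: (XsubC_exp_dvd_weight (r := r) pF a0 Se0).
  by rewrite size_section // mulnC.
have /dvdpP[Q ->] := dvP.
have -> : 'X^q - a%:P = ('X - a%:P) \Po 'X^q.
  by rewrite comp_polyB comp_polyX comp_polyC.
by rewrite mulrC -rmorphXn /= section_compM // dvdp_mulr.
Qed.

(** A polynomial in [X^q] has only its section at 0 nonzero, here the same power of [X - a]. *)
Lemma poly_weight_XnsubC_exp (F : fieldType) (p q : nat) (a : F) g r k :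
  p \in [pchar F] -> (0 < q)%N -> a != 0 -> (k < p)%N ->
  poly_weight (('X^q - a%:P) ^+ ((p ^ g).-1 * p ^ r.+1 + k * p ^ r))
  = (k.+1 * p ^ g)%N.
Proof.
move=> pF q0 a0 kp.
have -> : 'X^q - a%:P = ('X - a%:P) \Po 'X^q.
  by rewrite comp_polyB comp_polyX comp_polyC.
rewrite -rmorphXn /= -[_ \Po _]mulr1 (poly_weight_section _ q0).
have sec1 e : section q e 1 = (e == 0%N)%:R%:P :> {poly F}.
  by rewrite section_small ?size_polyC ?oner_eq0 // coefC; case: e.
rewrite (bigD1 (Ordinal q0)) //= section_compM // sec1 eqxx polyC1
  [_ ^+ _ * 1]mulr1.
rewrite (poly_weight_XsubC_exp pF) // big1 ?addn0 // => e /negPf e0.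
by rewrite section_compM // sec1 -val_eqE /= in e0 *; rewrite e0 mulr0
  poly_weight0.
Qed.

(** * Coordinates in R over the basis 1, u, v, uv *)

HB.instance Definition _ (F : comNzRingType) :=
  GRing.RMorphism.copy (@Rconst F)
    ((qpolyC ('X^2 : {poly dual F}) : dual F -> Ruv F) \o
     (qpolyC ('X^2 : {poly F}) : F -> dual F)).

Section Dual.

Variable B : comNzRingType.

Let qC (b : B) : dual B := qpolyC _ b.
Let qX : dual B := 'qX.

Lemma dual_coord (x : dual B) : exists a b, x = qC a + qC b * qX.
Proof.
have [f <-] := in_dual_surj x; exists f`_0, f`_1.
rewrite /qC /qX -!in_dualC -rmorphM -rmorphD /=; apply/eqP.
rewrite -subr_eq0 -rmorphB; apply/eqP/in_dual_eq0; exists (drop_poly 2 f).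
rewrite -{1}(poly_take_drop 2 f) addrAC -[RHS]add0r; congr (_ + _).
apply/polyP => i; rewrite !coefE.
by case: i => [|[|i]]; rewrite /= ?addr0 ?add0r ?subrr ?oppr0.
Qed.

Lemma dual_inj (a b : B) : qC a + qC b * qX = 0 -> a = 0 /\ b = 0.
Proof.
rewrite /qC /qX -!in_dualC -rmorphM -rmorphD => /in_dual_eq0[g gE].
have E i := congr1 (fun f : {poly B} => f`_i) gE.
by split; [move: (E 0%N) | move: (E 1%N)]; rewrite !coefE /= ?mulr0 ?mulr1
  ?addr0 ?add0r.
Qed.

Lemma dual_XX : qX * qX = 0.
Proof.
by rewrite /qX -rmorphM; apply/in_dual_eq0; exists 1; rewrite mul1r.
Qed.

End Dual.

Section Ruv.

Variable F : comNzRingType.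

Local Notation u := (Ru F).
Local Notation v := (Rv F).

Lemma Ru_sqr : u * u = 0.
Proof. by rewrite /Ru -rmorphM dual_XX rmorph0. Qed.

Lemma Rv_sqr : v * v = 0. Proof. exact: dual_XX. Qed.

(** The terms are grouped so that multiplication by [u] kills the second group and is injective on
    the first. *)
Lemma Ruv_coord (r : Ruv F) : exists a b c d,
  r = Rconst a + Rconst c * v + u * (Rconst b + Rconst d * v).
Proof.
have [x [y ->]] := dual_coord r.
have [a [b ->]] := dual_coord x; have [c [d ->]] := dual_coord y.
exists a, b, c, d; rewrite !rmorphD !rmorphM /= -/(Rconst a) -/(Rconst b).
rewrite -/(Rconst c) -/(Rconst d) -/u -/v mulrDr mulrDl.
by rewrite addrACA [u * Rconst b]mulrC mulrA [u * Rconst d]mulrC.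
Qed.

Lemma Ru_mul_eq0 (a c : F) :
  u * (Rconst a + Rconst c * v) = 0 -> a = 0 /\ c = 0.
Proof.
rewrite mulrDr mulrA /Ru /Rconst -!qpolyCM => /dual_inj [].
rewrite ![_ * qpolyC _ _]mulrC => h1 h2.
have := @dual_inj _ 0 a; have := @dual_inj _ 0 c.
by rewrite !rmorph0 !add0r => /(_ h2)[_ ->] /(_ h1)[_ ->].
Qed.

Lemma Ru_ann (r : Ruv F) : u * r = 0 -> exists r1, r = u * r1.
Proof.
have [a [b [c [d ->]]]] := Ruv_coord r.
rewrite mulrDr mulrA Ru_sqr mul0r addr0 => /Ru_mul_eq0 [-> ->].
by exists (Rconst b + Rconst d * v); rewrite rmorph0 mul0r !add0r.
Qed.

End Ruv.

(** * Constacyclic quotients through representatives of degree below N *)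

Section Constacyclic.

Variables (A : comNzRingType) (N : nat) (a : A).
Hypothesis N_gt0 : (0 < N)%N.
Implicit Types P : {poly A}.

Definition cproj : {poly A} -> constacyclic N a := in_qpoly ('X^N - a%:P).

HB.instance Definition _ := GRing.RMorphism.copy cproj (in_qpoly ('X^N - a%:P)).

Lemma cproj_small P : (size P <= N)%N ->
  (cproj P : {poly %/ ('X^N - a%:P : {poly A})}) = P :> {poly A}.
Proof.
by move=> szP; rewrite in_qpoly_small // mk_monic_constacyclic // size_XnsubC.
Qed.

Lemma cprojC c : cproj c%:P = cC N a c.
Proof.
apply/val_inj; rewrite [LHS]cproj_small //.
by rewrite (leq_trans (size_polyC_leq1 _)).
Qed.

Lemma cprojXn : cproj 'X^N = cC N a a.
Proof.
apply/eqP; rewrite -cprojC -subr_eq0 -rmorphB; apply/eqP/val_inj => /=.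
by rewrite mk_monic_constacyclic // Pdiv.RingMonic.rmodpp ?monicXnsubC.
Qed.

Lemma cproj_surj (c : constacyclic N a) :
  exists2 P : {poly A}, (size P <= N)%N & c = cproj P.
Proof.
pose P : {poly A} := (c : {poly %/ ('X^N - a%:P : {poly A})}).
have szP : (size P <= N)%N.
  rewrite -ltnS -(size_XnsubC a N_gt0) -(mk_monic_constacyclic a N_gt0).
  exact: size_mk_monic.
by exists P => //; apply/val_inj; rewrite [RHS]cproj_small.
Qed.

Lemma cproj_eq0 P : (size P <= N)%N -> cproj P = 0 -> P = 0.
Proof. by move=> /cproj_small {2}<- ->. Qed.

Lemma cC_mul_cproj c P : cC N a c * cproj P = cproj (c *: P).
Proof. by rewrite -cprojC -rmorphM mul_polyC. Qed.

Lemma hweight_cproj P : (size P <= N)%N ->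
  hweight (codeword (cproj P)) = poly_weight P.
Proof.
move=> szP; rewrite (poly_weightE szP) /hweight -sum1dep_card big_mkord
  big_mkcond.
by apply: eq_bigr => i _; rewrite mxE cproj_small //; case: ifP.
Qed.

Lemma hweight_cC_mul c (y : constacyclic N a) :
  (hweight (codeword (cC N a c * y)) <= hweight (codeword y))%N.
Proof.
have [P szP ->] := cproj_surj y.
have szcP := leq_trans (size_scale_leq c P) szP.
rewrite cC_mul_cproj !hweight_cproj // (poly_weightE szP) (poly_weightE szcP).
apply: leq_sum => i _; rewrite coefZ.
by case: (eqVneq P`_i 0) => [->|_]; rewrite ?mulr0 ?eqxx ?leq_b1.
Qed.

Lemma hweight_gt0 (y : constacyclic N a) :
  (0 < hweight (codeword y))%N = (y != 0).
Proof.
have [P szP ->] := cproj_surj y; rewrite hweight_cproj // poly_weight_gt0.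
congr (~~ _); apply/eqP/eqP => [->|]; first by rewrite rmorph0.
exact: cproj_eq0.
Qed.

End Constacyclic.

(** * Multiples of u in R_alpha, and reduction of codewords to them *)

Section ResidueCode.

Variables (F : fieldType) (q : nat) (a1 a3 a4 a0 : F).

Local Notation alpha := (Ralpha a1 a3 a4).
Local Notation S := (constacyclic (2 * q) alpha).
Local Notation u := (cu (2 * q) alpha).
Local Notation f := (cf (2 * q) alpha a0).
Local Notation fX := ('X^2 - a0%:P : {poly F}).

Hypothesis q_gt0 : (0 < q)%N.
Hypothesis a3_neq0 : a3 != 0.
(** In the application [q] is [p^s], and this is the Frobenius identity combined with
    [a0^q = a1]. *)
Hypothesis fX_exp : fX ^+ q = 'X^(2 * q) - a1%:P.

Let N_gt0 : (0 < 2 * q)%N. Proof. by rewrite muln_gt0. Qed.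

Implicit Types G : {poly F}.

(** Through [G |-> u * cpoly G], the ideal of multiples of [u] is a copy of [F[x]] modulo [f^(2q)]:
    see [u_mul_cpoly] and [u_cpoly_eq0]. *)
Definition cpoly (G : {poly F}) : S :=
  cproj (2 * q) alpha (map_poly (@Rconst F) G).

HB.instance Definition _ := GRing.RMorphism.copy cpoly
  (cproj (2 * q) alpha \o map_poly (@Rconst F)).

Lemma cpolyC c : cpoly c%:P = cC _ _ (Rconst c).
Proof. by rewrite /cpoly map_polyC /= cprojC. Qed.

Lemma cpoly_f : cpoly fX = f.
Proof. by rewrite rmorphB /= cpolyC rmorphXn /= /cpoly map_polyX. Qed.

Lemma f_exp_q :
  f ^+ q = cC _ _ (Rv F * (Rconst a3 + Rconst a4 * Ru F)).
Proof.
rewrite -cpoly_f -rmorphXn fX_exp rmorphB /= cpolyC {1}/cpoly map_polyXn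
  cprojXn //.
rewrite /cC -qpolyCN -qpolyCD; congr qpolyC.
by rewrite /Ralpha [LHS]addrC -addrA addKr mulrDr ![Rv F * _]mulrC mulrA.
Qed.

Lemma f_exp_2q : f ^+ (2 * q) = 0.
Proof.
by rewrite exprM exprAC f_exp_q expr2 /cC -qpolyCM mulrACA Rv_sqr mul0r qpolyC0.
Qed.

Lemma u_f_exp_q : u * f ^+ q = cC _ _ (Ru F * (Rconst a3 * Rv F)).
Proof.
rewrite f_exp_q /cu /cC -qpolyCM; congr qpolyC.
rewrite !mulrDr [Rv F * Rconst a3]mulrC [Rv F * (_ * _)]mulrA.
by rewrite [Ru F * (_ * Ru F)]mulrCA Ru_sqr mulr0 addr0.
Qed.

(** Scaling by [u] keeps the degree below [2q], so [u y = 0] holds coefficientwise and [Ru_ann]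
    applies to each coefficient. *)
Lemma u_ann (y : S) : u * y = 0 -> exists y1, y = u * y1.
Proof.
have [P szP ->] := cproj_surj N_gt0 y.
rewrite cC_mul_cproj // => /cproj_eq0 uP0.
have {}uP0 : Ru F *: P = 0.
  by apply: uP0 => //; rewrite (leq_trans (size_scale_leq _ _)).
suff [Q ->] : exists Q, P = Ru F *: Q.
  by exists (cproj (2 * q) alpha Q); rewrite cC_mul_cproj.
elim/poly_ind: P {szP} uP0 => [|P r IH] uP0; first by exists 0; rewrite scaler0.
have E i : Ru F * (P * 'X + r%:P)`_i = 0 by rewrite -coefZ uP0 coef0.
have [r1 rE] : exists r1, r = Ru F * r1.
  by apply: Ru_ann; move: (E 0%N); rewrite coefD coefMX coefC add0r.
have [Q QE] : exists Q, P = Ru F *: Q.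
  apply: IH; apply/polyP => i; rewrite coefZ coef0.
  by move: (E i.+1); rewrite coefD coefMX coefC addr0.
by exists (Q * 'X + r1%:P); rewrite rE QE scalerDr -scalerAl -!mul_polyC polyCM.
Qed.

(** The factor [u] kills the [u]-part of each coefficient, and [u v = u f^q / a3] trades [v] for a
    polynomial over [F]. *)
Lemma u_mul_cpoly (y : S) : exists G, u * y = u * cpoly G.
Proof.
have [P _ ->] := cproj_surj N_gt0 y.
elim/poly_ind: P => [|P r [G GE]]; first by exists 0; rewrite !rmorph0.
have [a [b [c [d rE]]]] := Ruv_coord r.
have [e cE] : exists e, c = a3 * e by exists (c / a3); rewrite mulrC divfK.
exists (G * 'X + a%:P + e%:P * fX ^+ q).
rewrite !rmorphD !rmorphM !mulrDr !mulrA GE rmorphXn /= cpoly_f.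
rewrite [cpoly 'X]/cpoly map_polyX -!addrA; congr (_ + _).
rewrite [u * _ * _]mulrAC u_f_exp_q !cpolyC cprojC //.
rewrite rE /cu /cC -!qpolyCM -qpolyCD; congr qpolyC.
rewrite mulrDr [Ru F * (Ru F * _)]mulrA Ru_sqr mul0r addr0 mulrDr.
congr (_ + _); first by rewrite qpolyCM.
by rewrite cE rmorphM -!mulrA [Rconst e * _]mulrC.
Qed.

Let w : Ruv F := Ru F * (Rconst a3 * Rv F).

Let size_scaled (b : Ruv F) G : (size G <= 2 * q)%N ->
  (size (b *: map_poly (@Rconst F) G) <= 2 * q)%N.
Proof.
by move=> szG; rewrite (leq_trans (size_scale_leq _ _)) //
  (leq_trans (size_poly _ _)).
Qed.

(** Multiplying by [u f^q] scales by the constant [a3 u v], which kills no nonzero element of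
    [F]. *)
Lemma hweight_u_f_exp_q G : (size G <= 2 * q)%N ->
  hweight (codeword (u * f ^+ q * cpoly G)) = poly_weight G.
Proof.
move=> szG; rewrite u_f_exp_q cC_mul_cproj // hweight_cproj ?size_scaled //.
rewrite (poly_weightE szG) (poly_weightE (size_scaled _ szG)).
apply: eq_bigr => i _; rewrite coefZ coef_map /=; congr (~~ _ : nat).
apply/eqP/eqP => [|->]; last by rewrite rmorph0 mulr0.
rewrite -mulrA mulrAC -(rmorphM (@Rconst F)) => uE.
have := @Ru_mul_eq0 _ 0 (a3 * G`_i); rewrite rmorph0 add0r => /(_ uE) [_ /eqP].
by rewrite mulf_eq0 (negPf a3_neq0) => /eqP.
Qed.

Let fXq_neq0 : fX ^+ q != 0.
Proof. by rewrite fX_exp -size_poly_gt0 size_XnsubC. Qed.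

Let size_modp_fXq G : (size (G %% fX ^+ q)%R <= 2 * q)%N.
Proof. by rewrite -ltnS -(size_XnsubC a1 N_gt0) -fX_exp ltn_modp. Qed.

Lemma u_f_exp_q_modp G :
  u * f ^+ q * cpoly G = u * f ^+ q * cpoly (G %% fX ^+ q).
Proof.
rewrite {1}(divp_eq G (fX ^+ q)) (rmorphD cpoly) (rmorphM cpoly)
  (rmorphXn cpoly) /= cpoly_f mulrDr.
by rewrite mulrC -mulrA mulrCA -mulrA -exprD addnn -mul2n f_exp_2q !mulr0 add0r.
Qed.

(** Let [R0] and [R1] be the two lowest digits of [G] in base [f^q]. Then [u G = u R0 + a3 u v R1]
    has degree below [2q], so both digits vanish coefficientwise. *)
Lemma u_cpoly_eq0 G : u * cpoly G = 0 -> fX ^+ (2 * q) %| G.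
Proof.
set Q := G %/ fX ^+ q; set R0 := G %% fX ^+ q; set R1 := Q %% fX ^+ q.
have -> : u * cpoly G = cproj _ alpha
    (Ru F *: map_poly (@Rconst F) R0 + w *: map_poly (@Rconst F) R1).
  rewrite rmorphD /= -!cC_mul_cproj //.
  rewrite -/(cpoly R0) -/(cpoly R1) -u_f_exp_q -u_f_exp_q_modp.
  rewrite {1}(divp_eq G (fX ^+ q)) (rmorphD cpoly) (rmorphM cpoly)
    (rmorphXn cpoly) /= cpoly_f mulrDr.
  by rewrite [LHS]addrC -mulrA [_ * f ^+ q]mulrC.
move=> /cproj_eq0 -/(_ N_gt0) coefs.
have /polyP {}coefs :
    Ru F *: map_poly (@Rconst F) R0 + w *: map_poly (@Rconst F) R1 = 0.
  apply: coefs; rewrite (leq_trans (size_polyD _ _)) // geq_max.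
  by rewrite !size_scaled // size_modp_fXq.
have R01 i : R0`_i = 0 /\ R1`_i = 0.
  have := coefs i; rewrite coefD !coefZ !coef_map coef0 /=.
  rewrite -mulrA -mulrDr mulrAC -(rmorphM (@Rconst F)) => /Ru_mul_eq0 [-> /eqP].
  by rewrite mulf_eq0 (negPf a3_neq0) => /eqP.
have R00 : R0 = 0 by apply/polyP => i; rewrite coef0; case: (R01 i).
have R10 : R1 = 0 by apply/polyP => i; rewrite coef0; case: (R01 i).
rewrite (divp_eq G (fX ^+ q)) -/R0 R00 addr0 -/Q (divp_eq Q (fX ^+ q)) -/R1 R10.
by rewrite addr0 -mulrA -exprD addnn -mul2n dvdp_mull.
Qed.

(** Reduction modulo [f^q] brings the degree below [2q] and, as [j <= q], preserves divisibility by
    [f^j]. *)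
Lemma hweight_u_f_exp_ge j (y : S) : (j <= q)%N -> u * f ^+ (q + j) * y != 0 ->
  exists G, [/\ G != 0, (size G <= 2 * q)%N, fX ^+ j %| G &
    hweight (codeword (u * f ^+ (q + j) * y)) = poly_weight G].
Proof.
move=> jq; have [G GE] := u_mul_cpoly y.
have -> : u * f ^+ (q + j) * y = u * f ^+ q * cpoly ((fX ^+ j * G) %% fX ^+ q).
  rewrite -u_f_exp_q_modp rmorphM rmorphXn /= cpoly_f exprD.
  by rewrite mulrAC GE mulrAC !mulrA.
move=> c0; exists ((fX ^+ j * G) %% fX ^+ q); split.
- by apply: contraNneq c0 => ->; rewrite rmorph0 mulr0.
- exact: size_modp_fXq.
- by rewrite -dvdp_mod ?dvdp_mulr // dvdp_exp2l.
- by rewrite hweight_u_f_exp_q // size_modp_fXq.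
Qed.

Variables (l t mu Im : nat) (z : S).

Local Notation gen := (code_gen a0 l t z).

Hypothesis l_le : (l <= 2 * q)%N.
Hypothesis z_form : z = 0 \/ is_unit z.
Hypothesis Im_least : least (fun k => ideal_gen [:: gen] (u * f ^+ k)) Im.
Hypothesis mu_lt : (mu < Im)%N.

Let mu_lt_of_multiple k r : u * f ^+ k = r * gen -> (mu < k)%N.
Proof.
move=> E; apply: leq_trans mu_lt _; apply: Im_least.2.
by exists (fun=> r); rewrite big_ord1.
Qed.

Let u_sqr : u * u = 0 :> S.
Proof. by rewrite /cu /cC -qpolyCM Ru_sqr qpolyC0. Qed.

Lemma mu_lt_l : (mu < l)%N.
Proof.
by apply: (@mu_lt_of_multiple _ u); rewrite mulrDr !mulrA u_sqr !mul0r addr0.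
Qed.

Let u_gen : u * gen = u * f ^+ l.
Proof. by rewrite mulrDr !mulrA u_sqr !mul0r addr0. Qed.

(** In [c = A gen + B u f^mu], [u c = 0] gives [u A f^l = 0], so [A] is a multiple of [f^(2q - l)]
    modulo [u]. That multiple turns [gen] into [u f^(2q - l + t) z], and the rest of [A] yields
    multiples of [u f^l]. *)
Lemma ann_u_code (c : S) : ideal_gen [:: gen; u * f ^+ mu] c -> u * c = 0 ->
  exists y, c = u * f ^+ mu * y.
Proof.
move=> [r ->]; rewrite !big_ord_recl big_ord0 addr0 /=.
set A := r 0%N; set B := r _.
rewrite mulrDr [u * (A * _)]mulrCA u_gen [u * (B * _)]mulrCA.
rewrite [u * (u * _)]mulrA u_sqr mul0r mulr0 addr0 => uAf.
have [G GE] := u_mul_cpoly A.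
have /dvdpP[Q GQ] : fX ^+ (2 * q - l) %| G.
  have fX0 : fX != 0 by rewrite -size_poly_gt0 size_XnsubC.
  rewrite -(dvdp_exp_sub _ _ _ fX0); apply: u_cpoly_eq0.
  by rewrite (rmorphM cpoly) (rmorphXn cpoly) /= cpoly_f mulrA -GE [u * A]mulrC
    -mulrA.
have [A1 AE] : exists A1, A = cpoly Q * f ^+ (2 * q - l) + u * A1.
  have [|A1 A1E] := @u_ann (A - cpoly Q * f ^+ (2 * q - l)).
    by rewrite mulrBr GE GQ rmorphM rmorphXn /= cpoly_f subrr.
  by exists A1; rewrite -A1E addrC subrK.
have fgen : f ^+ (2 * q - l) * gen = u * (f ^+ (2 * q - l + t) * z).
  rewrite mulrDr -exprD subnK // f_exp_2q add0r exprD.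
  by rewrite -!mulrA mulrCA.
suff [y yE] : exists y, u * (f ^+ (2 * q - l + t) * z) = u * f ^+ mu * y.
  exists (cpoly Q * y + A1 * f ^+ (l - mu) + B).
  rewrite AE mulrDl -mulrA fgen yE [u * A1 * _]mulrAC u_gen
    -[in u * f ^+ l](subnKC (ltnW mu_lt_l)).
  rewrite exprD !mulrDr; congr (_ + _ + _); last by rewrite mulrC.
    by rewrite mulrCA.
  by rewrite [A1 * _]mulrC !mulrA.
case: z_form => [->|[z' z'E]]; first by exists 0; rewrite !mulr0.
(* Clearing the unit [z] puts [u f^(2q - l + t)] in the ideal of [gen], so the minimality of [Im]
   bounds [mu]. *)
have /ltnW/subnKC <- : (mu < 2 * q - l + t)%N.
  apply: (@mu_lt_of_multiple _ (z' * f ^+ (2 * q - l))).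
  by rewrite -mulrA fgen mulrCA [z' * _]mulrCA z'E mulr1.
by exists (f ^+ (2 * q - l + t - mu) * z); rewrite exprD !mulrA.
Qed.

Lemma code_weight_reduce (c : S) :
  ideal_gen [:: gen; u * f ^+ mu] c -> c != 0 ->
  exists y, u * f ^+ mu * y != 0 /\
    (hweight (codeword (u * f ^+ mu * y)) <= hweight (codeword c))%N.
Proof.
move=> Cc c0; have [uc0|uc0] := eqVneq (u * c) 0.
  by have [y cE] := ann_u_code Cc uc0; exists y; rewrite -cE.
(* Multiplication by [u] leaves only a multiple of [u f^l], and [mu < l]. *)
have [y ucE] : exists y, u * c = u * f ^+ mu * y.
  case: Cc => r ->; rewrite !big_ord_recl big_ord0 addr0 /=.
  exists (r 0%N * f ^+ (l - mu)).
  rewrite mulrDr [u * (r 0%N * _)]mulrCA u_gen [u * (r _ * _)]mulrCA.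
  rewrite [u * (u * _)]mulrA u_sqr mul0r mulr0 addr0.
  by rewrite -[in LHS](subnKC (ltnW mu_lt_l)) exprD [RHS]mulrCA !mulrA.
by exists y; rewrite -ucE; split=> //; apply: hweight_cC_mul.
Qed.

Lemma mem_code (y : S) : ideal_gen [:: gen; u * f ^+ mu] (u * f ^+ mu * y).
Proof.
exists (nth 0 [:: 0; y]); rewrite !big_ord_recl big_ord0 /= mul0r add0r addr0.
exact: mulrC.
Qed.

End ResidueCode.

(** * The Hamming distance of the code *)

Theorem theorem4p7 (p m s : nat) (F : finFieldType) (a1 a3 a4 a0 : F)
  (l t mu Im : nat) (z : constacyclic (2 * p ^ s)%N (Ralpha a1 a3 a4)) :
  prime p -> odd p -> (0 < m)%N -> (0 < s)%N -> #|F| = (p ^ m)%N ->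
  a1 != 0 -> a3 != 0 -> a4 != 0 ->
  ~ (exists b : Ruv F, b ^+ 2 = Ralpha a1 a3 a4) ->
  a0 ^+ (p ^ s) = a1 ->
  (l <= 2 * p ^ s - 1)%N -> (t < l)%N ->
  (z = 0 \/ is_unit z /\ unit_form a0 z) ->
  least (fun k => ideal_gen [:: code_gen a0 l t z]
                    (cu _ _ * cf _ _ a0 ^+ k)) Im ->
  (mu < Im)%N ->
  let dH := hamming_distance
    (ideal_gen [:: code_gen a0 l t z; cu _ _ * cf _ _ a0 ^+ mu]) in
  let range G g :=
    [/\ (1 <= G <= p - 1)%N, (g <= s - 1)%N &
        (2 * p ^ s - p ^ (s - g) + (G - 1) * p ^ (s - g - 1) + 1 <= mu
           <= 2 * p ^ s - p ^ (s - g) + G * p ^ (s - g - 1))%N] in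
  [/\ (mu <= p ^ s)%N -> dH 1%N,
      forall G g : nat, range G g -> dH ((G + 1) * p ^ g)%N &
      (mu <= p ^ s)%N \/ exists G g : nat, range G g].
Proof.
move=> p_pr _ _ s_gt0 cardF a1_neq0 a3_neq0 _ _ a0E l_le _ z_form.
move=> Im_least mu_lt dH range; have p_gt0 := prime_gt0 p_pr.
have pF := card_finPcharP cardF p_pr.
have q_gt0 : (0 < p ^ s)%N by rewrite expn_gt0 p_gt0.
have N_gt0 : (0 < 2 * p ^ s)%N by rewrite muln_gt0.
have a0_neq0 : a0 != 0.
  by apply: contraNneq a1_neq0 => a00; rewrite -a0E a00 expr0n gtn_eqF.
have fX_exp : ('X^2 - a0%:P) ^+ (p ^ s) = 'X^(2 * p ^ s) - a1%:P.
  rewrite exprBn_pchar -?exprM -?rmorphXn ?a0E //.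
  by rewrite pnatX pnatE // pchar_poly pF.
(* With [r = s - g - 1], the ranges for [mu] become the blocks of [digit_position] shifted by
   [p^s]. *)
have gapE g r : s = (g + r).+1 ->
    (2 * p ^ s - p ^ r.+1 = p ^ s + (p ^ g).-1 * p ^ r.+1)%N.
  move=> ->; rewrite -addnS expnD -subn1 mulnBl mul1n addnBA ?addnn ?mul2n //.
  by rewrite leq_pmull // expn_gt0 p_gt0.
have l_le2 : (l <= 2 * p ^ s)%N by rewrite (leq_trans l_le) // leq_subr.
have z_form' : z = 0 \/ is_unit z by case: z_form => [|[]]; [left | right].
set f := cf (2 * p ^ s) (Ralpha a1 a3 a4) a0.
set u := cu (2 * p ^ s) (Ralpha a1 a3 a4).
have in_code j : (mu <= j)%N -> exists y, u * f ^+ j = u * f ^+ mu * y.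
  by move=> /subnKC <-; exists (f ^+ (j - mu)); rewrite exprD mulrA.
(* The codeword [u f^(p^s + E)] has the weight of [(X^2 - a0)^E], so only the lower bound is left to
   each case. *)
have dH_of_word E : (mu <= p ^ s + E)%N -> (E < p ^ s)%N ->
    (forall c, ideal_gen [:: code_gen a0 l t z; u * f ^+ mu] c -> c != 0 ->
       (poly_weight (('X^2 - a0%:P : {poly F}) ^+ E)%R
          <= hweight (codeword c))%N) ->
    dH (poly_weight (('X^2 - a0%:P : {poly F}) ^+ E)).
  move=> muE Elt lower; split; last by move=> _ [c [Cc c0 <-]]; apply: lower.
  have szE : (size (('X^2 - a0%:P : {poly F}) ^+ E) <= 2 * p ^ s)%N.
    by rewrite (leq_trans (size_poly_exp_leq _ _)) // size_XnsubC //= ltn_mul2l.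
  have wE := hweight_u_f_exp_q a4 q_gt0 a3_neq0 fX_exp szE.
  exists (u * f ^+ (p ^ s + E)); rewrite exprD mulrA.
  have fE : f ^+ E = cpoly (p ^ s) a1 a3 a4 (('X^2 - a0%:P) ^+ E).
    by rewrite (rmorphXn (cpoly _ _ _ _)) /= cpoly_f.
  split; last by rewrite fE.
    by rewrite -mulrA -exprD; have [y ->] := in_code _ muE; apply: mem_code.
  rewrite -hweight_gt0 // fE wE poly_weight_gt0 expf_neq0 //.
  by rewrite -size_poly_gt0 size_XnsubC.
split=> [mu_le|G g [/andP[G1 Gp] gs muP]|].
- have w1 : poly_weight (('X^2 - a0%:P : {poly F}) ^+ 0) = 1%N.
    by rewrite /poly_weight size_polyC oner_eq0 big_nat1 coefC /= oner_eq0.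
  rewrite -w1; apply: dH_of_word; rewrite ?addn0 // w1 => c _.
  by rewrite hweight_gt0.
- set r := (s - g - 1)%N in muP.
  have sE : s = (g + r).+1 by rewrite /r; lia.
  have sgE : (s - g = r.+1)%N by lia.
  (* The minimal word is taken at the right end [E0 + G p^r] of the block containing [mu - p^s]. *)
  rewrite sgE (gapE _ _ sE) in muP; set E0 := ((p ^ g).-1 * p ^ r.+1)%N in muP.
  have Elt : (E0 + G * p ^ r < p ^ s)%N.
    have := gapE g r sE; rewrite -/E0.
    have : (G * p ^ r < p ^ r.+1)%N.
      by rewrite expnS ltn_mul2r expn_gt0 p_gt0 (leq_ltn_trans Gp) // subn1
        ltn_predL.
    lia.
  have GP : (G < p)%N by lia.
  rewrite addn1 -(poly_weight_XnsubC_exp g r pF (isT : (0 < 2)%N) a0_neq0 GP).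
  apply: dH_of_word => //; first by move/andP: muP => [_ mule]; rewrite addnA.
  rewrite poly_weight_XnsubC_exp // => c Cc c0.
  have [y [y0 wle]] :=
    code_weight_reduce q_gt0 a3_neq0 fX_exp l_le2 z_form' Im_least mu_lt Cc c0.
  apply: leq_trans wle; move: y0.
  pose j := (mu - p ^ s)%N.
  have jE : (p ^ s + j = mu)%N by rewrite /j; lia.
  rewrite -jE => y0.
  have [|P [P0 szP dvP ->]] := hweight_u_f_exp_ge q_gt0 a3_neq0 fX_exp _ y0.
    by lia.
  (* The lower bound is applied with [k = G - 1], since [mu - p^s] exceeds [E0 + (G - 1) p^r]. *)
  rewrite -[G](prednK G1).
  apply: (XnsubC_exp_dvd_weight (r := r) pF (isT : (0 < 2)%N) a0_neq0 P0).
    by rewrite -sE.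
  by apply: dvdp_trans dvP; apply: dvdp_exp2l; rewrite -/E0 -subn1; lia.
(* The ranges cover all remaining [mu]: from [mu < l <= 2 p^s - 1], [mu - p^s] lies below [p^s]. *)
have mu_lt_l : (mu < l)%N by apply: mu_lt_l Im_least mu_lt.
have [|mu_gt] := leqP mu (p ^ s); [by left | right].
have [|g [r [k [sE kp /andP[lo hi]]]]] :=
    @digit_position p s (mu - p ^ s) p_gt0.
  by lia.
have sgE : (s - g = r.+1)%N by lia.
have sg1E : (r.+1 - 1 = r)%N by lia.
exists k.+1, g; rewrite /range sgE sg1E (gapE _ _ sE) subn1 /=.
by split; lia.
Qed.
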